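(* Let $n=2\mathsf r+\mathsf s$ with $\mathsf r,\mathsf s>0$ and $D=(\varpi_{\mathsf r}+\varpi_{\mathsf r+\mathsf s}-\varpi_0)[\infty]$ (no finite points). Let $K$ be the $\mathsf r\times\mathsf r$ block of $T_D(z)$ formed by rows $\mathsf r+\mathsf s+1,\dots,n$ and columns $1,\dots,\mathsf r$, and $\bar K$ the $\mathsf r\times\mathsf r$ block formed by rows $1,\dots,\mathsf r$ and columns $\mathsf r+\mathsf s+1,\dots,n$. Then $K,\bar K$ are independent of $z$ and $K\cdot\bar K=-I_{\mathsf r}$.
   Context: Let $\Lambda=\bigoplus_{j=1}^n\mathbb{Z}\epsilon_j$, $\alpha_i=\epsilon_i-\epsilon_{i+1}$, $\varpi_i=-\sum_{j=i+1}^n\epsilon_j$. Here $\mu=\varpi_{\mathsf r}+\varpi_{\mathsf r+\mathsf s}-\varpi_0=\sum_ia_i\alpha_i$ with $a_i=i$ for $i\le\mathsf r$, $a_i=\mathsf r$ for $\mathsf r\le i\le\mathsf r+\mathsf s$, $a_i=n-i$ for $i\ge\mathsf r+\mathsf s$; $a_0=a_n=0$. $\mathcal{A}$: the $\mathbb{C}$-algebra generated by $p_{i,r},e^{\pm q_{i,r}},(p_{i,r}-p_{i,s}+m)^{-1}$ ($1\le i<n$, $1\le r\ne s\le a_i$, $m\in\mathbb{Z}$) with $[e^{\pm q_{i,r}},p_{j,s}]=\mp\delta_{ij}\delta_{rs}e^{\pm q_{i,r}}$, $p$'s commuting, $e^q$'s commuting, $e^{\pm q_{i,r}}e^{\mp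 q_{i,r}}=1$. $P_j(z)=\prod_{r=1}^{a_j}(z-p_{j,r})$, $P_{j,r}(z)=\prod_{s\ne r}(z-p_{j,s})$, $P_0=P_n=1$. $T_D(z)\in\mathcal{A}((z^{-1}))\otimes\mathrm{End}\,\mathbb{C}^n$: $T_D(z)_{\alpha\beta}=\sum_{i=1}^{\min(\alpha,\beta)}f^D_{\alpha i}(z)g^D_i(z)e^D_{i\beta}(z)$, where (expanded in $z^{-1}$) $g^D_i(z)=\frac{P_i(z)}{P_{i-1}(z-1)}$, $e^D_{ii}=f^D_{ii}=1$ and for $i<j$: $e^D_{ij}(z)=-\sum_{r_i,\dots,r_{j-1}}\frac{P_{i-1}(p_{i,r_i}-1)\prod_{k=i}^{j-2}P_{k,r_k}(p_{k+1,r_{k+1}}-1)}{(z-p_{i,r_i})\prod_{k=i}^{j-1}P_{k,r_k}(p_{k,r_k})}\, e^{\sum_{k=i}^{j-1}q_{k,r_k}}$, $f^D_{ji}(z)=\sum_{r_i,\dots,r_{j-1}}\frac{P_j(p_{j-1,r_{j-1}}+1)\prod_{k=i+1}^{j-1}P_{k,r_k}(p_{k-1,r_{k-1}}+1)}{(z-p_{i,r_i}-1)\prod_{k=i}^{j-1}P_{k,r_k}(p_{k,r_k})}\, e^{-\sum_{k=i}^{j-1}q_{k,r_k}}$ (sums over $1\le r_k\le a_k$). *)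

(* Defs.v *)
From mathcomp Require Import all_boot all_algebra.
From mathcomp Require Import reals complex.
From mathcomp Require Import mpoly.

Set Implicit Arguments.
Unset Strict Implicit.
Unset Printing Implicit Defensive.
Import GRing.Theory.
Local Open Scope ring_scope.

(* Model of the algebra A and of A((z^-1)).                                   *)
(* The ground field is C := R[i] for an arbitrary realType R (i.e. the complex *)
(* numbers).  Let Fld be the field of rational functions over C in the        *)
(* commuting variables z and p_{i,r} (1 <= i < n, 1 <= r <= a_i); to keep the *)
(* indexing simple we use NV = n*n+1 variables: p_{i,r} is the variable of     *)
(* index i*n + (r-1) and z the variable of index n*n (the others are unused). *)
(* Elements of the algebra are finite formal sums  sum_k c_k e^{m_k . q}      *)
(* (c_k in Fld written to the LEFT of the exponential, m_k in Z^NV), encoded   *)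
(* as sequences of pairs (c_k, m_k); two such sums are equal iff they have    *)
(* the same coefficient at every exponent vector (eltEq).  The product is the *)
(* one forced by [e^{+-q_{i,r}}, p_{j,s}] = -+ d_ij d_rs e^{+-q_{i,r}}, i.e.  *)
(*   (c e^{m.q}) (c' e^{m'.q}) = c * c'(p - m) e^{(m+m').q}.                  *)
(* This skew Laurent ring contains A (and A((z^-1)) via expansion of rational *)
(* functions of z at z = oo, which is an injective morphism commuting with    *)
(* the p-shifts), so identities in A((z^-1)) are identities here.             *)

Section Model.
Variable R : realType.
Variables rr ss : nat.

Definition nn : nat := (2 * rr + ss)%N.
Definition NV : nat := (nn * nn).+1.

Definition aa (i : nat) : nat :=
  if (i <= rr)%N then i else if (i <= rr + ss)%N then rr else (nn - i)%N.

Definition Pol := {mpoly R[i][NV]}.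
Local Notation "x %:F" := (@FracField.tofrac Pol x).
Definition Fld := {fraction Pol}.
Definition Ex := {ffun 'I_NV -> int}.
Definition Elt := seq (Fld * Ex).

Definition pidx (i r : nat) : 'I_NV := inord (i * nn + r.-1).
Definition zidx : 'I_NV := inord (nn * nn).

Definition pv (i r : nat) : Fld := ('X_(pidx i r) : Pol)%:F.
Definition zv : Fld := ('X_zidx : Pol)%:F.
Definition qexp (i r : nat) : Ex := [ffun j => if j == pidx i r then 1 else 0].

Definition shiftP (m : Ex) (p : Pol) : Pol :=
  mmap (@mpolyC NV R[i]) (fun j => if j == zidx then 'X_j else 'X_j - (m j)%:~R) p.
Definition shiftF (m : Ex) (x : Fld) : Fld :=
  (shiftP m (\n_(repr x)))%:F / (shiftP m (\d_(repr x)))%:F.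

Definition ex0 : Ex := [ffun => 0].
Definition eltC (c : Fld) : Elt := [:: (c, ex0)].
Definition eltMul (u v : Elt) : Elt :=
  [seq ((x.1 * shiftF x.2 y.1, [ffun j => x.2 j + y.2 j]) : Fld * Ex)
  | x : Fld * Ex <- u, y : Fld * Ex <- v].
Definition eltCoef (u : Elt) (m : Ex) : Fld := \sum_(x <- u | x.2 == m) x.1.
Definition eltEq (u v : Elt) : Prop := forall m, eltCoef u m = eltCoef v m.

Definition zfree_poly (p : Pol) : Prop :=
  forall m : 'X_{1..NV}, m \in msupp p -> m zidx = 0%N.
Definition zfree (x : Fld) : Prop :=
  exists a b : Pol, [/\ zfree_poly a, zfree_poly b, b != 0 & x = a%:F / b%:F].

Definition Pj (j : nat) (w : Fld) : Fld := \prod_(1 <= t < (aa j).+1) (w - pv j t).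
Definition Pjr (j r : nat) (w : Fld) : Fld :=
  \prod_(1 <= t < (aa j).+1 | t != r) (w - pv j t).

(* choices (r_k)_k, encoded by rho : 'I_n -> 'I_n with r_k = rho k + 1 *)
Definition rsel (rho : {ffun 'I_nn -> 'I_nn}) (k : nat) : nat :=
  oapp (fun k' : 'I_nn => (rho k' : nat).+1) 0%N (insub k).
Definition valid (i j : nat) : pred {ffun 'I_nn -> 'I_nn} :=
  fun rho => [forall k : 'I_nn,
    if (i <= k < j)%N then (rho k < aa k)%N else (rho k : nat) == 0%N].
Definition sumq (i j : nat) (rho : {ffun 'I_nn -> 'I_nn}) : Ex :=
  [ffun t => \sum_(i <= k < j) qexp k (rsel rho k) t].

Definition eCoef (i j : nat) (rho : {ffun 'I_nn -> 'I_nn}) : Fld :=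
  let r := rsel rho in
  - (Pj i.-1 (pv i (r i) - 1) *
     \prod_(i <= k < j.-1) Pjr k (r k) (pv k.+1 (r k.+1) - 1))
  / ((zv - pv i (r i)) * \prod_(i <= k < j) Pjr k (r k) (pv k (r k))).
Definition eD (i j : nat) : Elt :=
  if i == j then eltC 1
  else if (i < j)%N then [seq (eCoef i j rho, sumq i j rho) | rho <- enum (valid i j)]
  else [::].

Definition fCoef (j i : nat) (rho : {ffun 'I_nn -> 'I_nn}) : Fld :=
  let r := rsel rho in
  (Pj j (pv j.-1 (r j.-1) + 1) *
     \prod_(i.+1 <= k < j) Pjr k (r k) (pv k.-1 (r k.-1) + 1))
  / ((zv - pv i (r i) - 1) * \prod_(i <= k < j) Pjr k (r k) (pv k (r k))).
Definition fD (j i : nat) : Elt :=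
  if i == j then eltC 1
  else if (i < j)%N then
    [seq (fCoef j i rho, [ffun t => - sumq i j rho t]) | rho <- enum (valid i j)]
  else [::].

Definition gD (i : nat) : Elt := eltC (Pj i zv / Pj i.-1 (zv - 1)).

Definition TD (al be : nat) : Elt :=
  flatten [seq eltMul (eltMul (fD al i) (gD i)) (eD i be) | i <- iota 1 (minn al be)].

Definition Kblk (a b : nat) : Elt := TD (rr + ss + a) b.
Definition Kbar (a b : nat) : Elt := TD a (rr + ss + b).
Definition KKbar (a b : nat) : Elt :=
  flatten [seq eltMul (Kblk a c) (Kbar c b) | c <- iota 1 rr].

End Model.

(* Main.v *)
(* Fix the matrix entry (al, be).  Moving the exponentials to the right, the
   i-th summand f_{al,i} g_i e_{i,be} becomes a sum over selections (r_k), (r'_k)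
   of terms rational in z with simple poles only at p_{i-1,s} + 1 and at the
   shifted p_{i,r'_i}.  The residue at the latter vanishes unless r_i = r'_i = t;
   then e^{-q_{i,t}} and e^{q_{i,t}} cancel, the pole is p_{i,t} + 1, and the residue
   is opposite to the residue at p_{i,t} + 1 of the TD_term of the (i+1)-st summand
   with the tails (r_k)_{k>i}, (r'_k)_{k>i}.  Hence the sum over all poles x of
   (residue at x) * h(x) is 0 for every function h.
   Taking h(x) = 1/(z-x) shows that T_{al,be} is the sum of the polynomial parts
   of its terms; for K and Kbar only i = min(al,be) contributes, with the constants
   lim z f_{al,be} and lim z e_{al,be}.  Taking h = 1 for al, be > r + s, and
   reading the sum of residues as a coefficient of 1/z, gives
   sum_{c <= r} K_{al,c} Kbar_{c,be} + delta_{al,be} = 0. *)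
From HB Require Import structures.
Require Import Defs.
From mathcomp Require Import all_boot all_algebra.
From mathcomp Require Import reals complex.
From mathcomp Require Import mpoly.
From mathcomp Require Import zify ring.
Set Implicit Arguments.
Unset Strict Implicit.
Unset Printing Implicit Defensive.
Import GRing.Theory.
Local Open Scope ring_scope.
Local Notation "x %:F" := (@FracField.tofrac _ x).

(** * Partial fractions *)

Section PartialFractions.
Variable L : fieldType.
Implicit Types (xs : seq L) (N : {poly L}).

Definition node_cofactor xs x : {poly L} := \prod_(y <- xs | y != x) ('X - y%:P).

(** The difference of the two sides vanishes at every node but has size at most [size xs], so a
    nonzero difference would have too many roots. *)
Lemma lagrange_interpolation xs N : uniq xs -> (size N <= size xs)%N ->
  N = \sum_(x <- xs) (N.[x] / (node_cofactor xs x).[x]) *: node_cofactor xs x.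
Proof.
move=> Uxs sN; apply/eqP; rewrite -subr_eq0; apply: contraTT isT => D0.
have cof0 x : (node_cofactor xs x).[x] != 0.
  by rewrite horner_prod prodf_seq_neq0; apply/allP => y _; apply/implyP;
    rewrite hornerXsubC subr_eq0 eq_sym.
set D := (X in X != 0) in D0; suff: (size xs < size D)%N.
  rewrite ltnNge => /negP; case; apply: leq_trans (size_polyD _ _) _.
  rewrite geq_max sN size_polyN; apply: leq_trans (size_sum _ _ _) _.
  apply/bigmax_leqP_seq => x xxs _; apply: leq_trans (size_scale_leq _ _) _.
  rewrite /node_cofactor -big_filter size_prod_XsubC size_filter.
  by rewrite -(count_predC (pred1 x) xs) (count_uniq_mem _ Uxs) xxs.
apply: max_poly_roots => //; apply/allP => x xxs.
rewrite rootE hornerD hornerN horner_sum (bigD1_seq x) //= hornerZ divfK //.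
rewrite big1_seq ?addr0 ?subrr // => y /andP[yx yxs].
rewrite hornerZ [_.[x]](_ : _ = 0) ?mulr0 //.
apply/eqP; rewrite horner_prod prodf_seq_eq0; apply/hasP; exists x => //=.
by rewrite hornerXsubC subrr eqxx eq_sym yx.
Qed.

(** Compare top coefficients in the interpolation formula, where every cofactor is monic of degree
    [(size xs).-1]. The left side is the coefficient of 1/z at infinity of [N] over the product of
    the X - x. *)
Lemma sum_residues xs N : uniq xs -> (size N <= size xs)%N ->
  N`_(size xs).-1 = \sum_(x <- xs) N.[x] / \prod_(y <- xs | y != x) (x - y).
Proof.
move=> Uxs sN; rewrite [in LHS](lagrange_interpolation Uxs sN) coef_sum.
apply: eq_big_seq => x xxs; rewrite coefZ.
rewrite [(node_cofactor _ _)`_ _](_ : _ = 1) ?mulr1 ?horner_prod.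
  by congr (_ / _); apply: eq_bigr => y _; rewrite hornerXsubC.
rewrite /node_cofactor -big_filter; apply/eqP.
have /monicP <- := monic_prod_XsubC [seq y <- xs | y != x] xpredT id.
rewrite lead_coefE size_prod_XsubC size_filter /=.
by rewrite -(count_predC (pred1 x) xs) (count_uniq_mem _ Uxs) xxs.
Qed.

Lemma partial_fractions xs N z : uniq xs -> (size N <= (size xs).+1)%N -> z \notin xs ->
  N.[z] / \prod_(x <- xs) (z - x) =
  N`_(size xs) + \sum_(x <- xs) N.[x] / \prod_(y <- xs | y != x) (x - y) * (z - x)^-1.
Proof.
move=> Uxs sN zxs; pose W : {poly L} := \prod_(x <- xs) ('X - x%:P).
have W0 x : x \in xs -> W.[x] = 0.
  by move=> xxs; apply/eqP; rewrite -/(root _ _) root_prod_XsubC.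
have Wz : W.[z] = \prod_(x <- xs) (z - x).
  by rewrite horner_prod; apply: eq_bigr => y _; rewrite hornerXsubC.
have Wz0 : W.[z] != 0 by rewrite -/(root _ _) root_prod_XsubC.
(* [W] is monic of degree [size xs], so subtracting [c *: W] leaves a numerator to which
   interpolation applies, with the same values at the nodes. *)
pose c := N`_(size xs); pose M := N - c *: W.
have sM : (size M <= size xs)%N.
  apply/leq_sizeP => j; rewrite leq_eqVlt => /predU1P[<-|lj].
    rewrite coefB coefZ.
    have /monicP := monic_prod_XsubC xs xpredT id.
    by rewrite lead_coefE size_prod_XsubC /= => ->; rewrite mulr1 subrr.
  rewrite coefB coefZ !nth_default ?mulr0 ?subr0 ?size_prod_XsubC //.
  exact: leq_trans sN _.
rewrite -Wz; apply: (mulIf Wz0); rewrite divfK // mulrDl.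
have -> : N.[z] = M.[z] + c * W.[z] by rewrite hornerD hornerN hornerZ subrK.
rewrite addrC -/c; congr (_ + _).
rewrite [in LHS](lagrange_interpolation Uxs sM) horner_sum mulr_suml.
apply: eq_big_seq => x xxs.
rewrite hornerZ hornerD hornerN hornerZ (W0 x) // mulr0 subr0 /node_cofactor.
rewrite horner_prod; under eq_bigr do rewrite hornerXsubC.
rewrite -!mulrA; congr (_ * (_ * _)).
rewrite horner_prod; under eq_bigr do rewrite hornerXsubC.
rewrite Wz (bigD1_seq x) //= mulKf // subr_eq0.
by apply: contraNneq zxs => ->.
Qed.

End PartialFractions.

(** * Residues of the summands *)

Section Coefficients.
Variables (L : fieldType) (a : nat -> nat).
Implicit Types (p : nat -> nat -> L) (r : nat -> nat).

(* These restate [Pj], [Pjr], [fCoef], [eCoef] (the latter two without their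
   [z]-dependent factor) for arbitrary values [p], so that an automorphism acts
   on them just by replacing [p]. *)
Definition Pw p j (w : L) := \prod_(1 <= t < (a j).+1) (w - p j t).
Definition Pwr p j s (w : L) := \prod_(1 <= t < (a j).+1 | t != s) (w - p j t).

Definition fres p al i r : L :=
  (Pw p al (p al.-1 (r al.-1) + 1) *
     \prod_(i.+1 <= k < al) Pwr p k (r k) (p k.-1 (r k.-1) + 1))
  / \prod_(i <= k < al) Pwr p k (r k) (p k (r k)).
Definition eres p i be r : L :=
  - (Pw p i.-1 (p i (r i) - 1) *
     \prod_(i <= k < be.-1) Pwr p k (r k) (p k.+1 (r k.+1) - 1))
  / \prod_(i <= k < be) Pwr p k (r k) (p k (r k)).

Definition fval p al i r w := if (i < al)%N then fres p al i r / (w - p i (r i) - 1) else 1.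
Definition eval p i be r w := if (i < be)%N then eres p i be r / (w - p i (r i)) else 1.

(* Values of the [p]'s after conjugation by [e^{-(q_{i,r_i} + ... + q_{al-1,r_{al-1}})}]. *)
Definition shifted p i al r k t : L := p k t + ((i <= k < al)%N && (t == r k))%:R.

(* [f_{al,i}(z)] times the shifted [P_i(z)]; the pole of [f_{al,i}] cancels. *)
Definition fpoly p al i r : {poly L} :=
  if (i < al)%N then
    fres p al i r *: \prod_(1 <= t < (a i).+1 | t != r i) ('X - (p i t)%:P)
  else \prod_(1 <= t < (a i).+1) ('X - (p i t)%:P).

Lemma Pw_split p j s w : (0 < s <= a j)%N -> Pw p j w = Pwr p j s w * (w - p j s).
Proof.
move=> sj; rewrite /Pw /Pwr (bigD1_seq s) ?iota_uniq //=; last by rewrite mem_index_iota; lia.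
by rewrite mulrC.
Qed.

Lemma eq_Pw p1 p2 j w : (forall t, p1 j t = p2 j t) -> Pw p1 j w = Pw p2 j w.
Proof. by move=> e; apply: eq_bigr => t _; rewrite e. Qed.

Lemma eq_Pwr p1 p2 j s w : (forall t, t != s -> p1 j t = p2 j t) -> Pwr p1 j s w = Pwr p2 j s w.
Proof. by move=> e; apply: eq_bigr => t ts; rewrite e. Qed.

Lemma fres_eq p al i r1 r2 : (i < al)%N -> (forall k, (i <= k)%N -> r1 k = r2 k) ->
  fres p al i r1 = fres p al i r2.
Proof.
move=> ial e; rewrite /fres; have -> : r1 al.-1 = r2 al.-1 by apply: e; lia.
congr (_ * _ / _); apply: eq_big_nat => k kk; rewrite !e //; lia.
Qed.

Lemma eres_eq p1 p2 i be r1 r2 : (i < be)%N -> (forall k, (i <= k)%N -> r1 k = r2 k) ->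
  (forall k t, (i.-1 <= k)%N -> p1 k t = p2 k t) ->
  eres p1 i be r1 = eres p2 i be r2.
Proof.
move=> ibe er ep; rewrite /eres er // ep ?(eq_Pw (p2 := p2)) //; try lia; last first.
  by move=> t; apply: ep.
by congr (- (_ * _) / _); apply: eq_big_nat => k kk; rewrite !er ?ep ?(eq_Pwr (p2 := p2)) //;
  try lia; move=> t _; apply: ep; lia.
Qed.

Lemma fpoly_eq p al i r1 r2 : (forall k, (i <= k)%N -> r1 k = r2 k) ->
  fpoly p al i r1 = fpoly p al i r2.
Proof. by move=> e; rewrite /fpoly; case: ifP => // ial; rewrite (fres_eq _ ial e) e. Qed.

Lemma eval_eq p1 p2 i be r1 r2 w : (forall k, (i <= k)%N -> r1 k = r2 k) ->
  (forall k t, (i.-1 <= k)%N -> p1 k t = p2 k t) ->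
  eval p1 i be r1 w = eval p2 i be r2 w.
Proof.
move=> er ep; rewrite /eval; case: ifP => // ibe.
by rewrite (eres_eq ibe er ep) er // ep //; lia.
Qed.

Lemma shifted_eq p i al r1 r2 k t : (forall k, (i <= k)%N -> r1 k = r2 k) ->
  shifted p i al r1 k t = shifted p i al r2 k t.
Proof. by move=> e; rewrite /shifted; case: (leqP i k) => // ik; rewrite e. Qed.

Lemma size_filter_neq m s : (0 < s <= m)%N ->
  size [seq t <- index_iota 1 m.+1 | t != s] = m.-1.
Proof.
move=> sm; rewrite -rem_filter ?iota_uniq // size_rem ?size_iota ?subn1 //.
by rewrite mem_index_iota; lia.
Qed.

Lemma size_fpoly p al i r : (i <= al)%N -> (i < al -> 0 < r i <= a i)%N ->
  (size (fpoly p al i r) <= (a i).+1 - (i < al))%N.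
Proof.
move=> ial ri; rewrite /fpoly; case: ltnP ri => lt ri.
  apply: leq_trans (size_scale_leq _ _) _.
  rewrite -big_filter size_prod_XsubC size_filter_neq ?ri // subn1 /=; have := ri isT; lia.
by rewrite size_prod_XsubC size_iota; lia.
Qed.

Lemma lead_fpoly p al i r : (i <= al)%N -> (i < al -> 0 < r i <= a i)%N ->
  (fpoly p al i r)`_(a i - (i < al)) = if (i < al)%N then fres p al i r else 1.
Proof.
move=> ial ri; rewrite /fpoly; case: ltnP ri => lt ri.
  rewrite coefZ -big_filter subn1.
  have /monicP := monic_prod_XsubC [seq i0 <- index_iota 1 (a i).+1 | i0 != r i] xpredT (p i).
  by rewrite lead_coefE size_prod_XsubC size_filter_neq ?ri //= => ->; rewrite mulr1.
have /monicP := monic_prod_XsubC (index_iota 1 (a i).+1) xpredT (p i).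
rewrite lead_coefE size_prod_XsubC size_iota /= subn0 => <-.
by congr (_ `_ _); lia.
Qed.

Lemma fpoly_horner p al i r w : (i <= al)%N ->
  (fpoly p al i r).[w] = if (i < al)%N then fres p al i r * Pwr p i (r i) w else Pw p i w.
Proof.
move=> ial; rewrite /fpoly; case: ltnP => lt.
  by rewrite hornerZ horner_prod; under eq_bigr do rewrite hornerXsubC.
by rewrite horner_prod; under eq_bigr do rewrite hornerXsubC.
Qed.

(** * Cancellation of residues of neighbouring summands at generic points *)

Section Generic.
Variable p : nat -> nat -> L.
(** Genericity keeps the poles distinct after integer shifts, so that they are all simple and no
    denominator vanishes. *)
Hypothesis gen : forall i s j t (m : int), (0 < s <= a i)%N -> (0 < t <= a j)%N ->
  (i, s) != (j, t) -> p i s - p j t != m%:~R.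

Let gen0 i s j t : (0 < s <= a i)%N -> (0 < t <= a j)%N ->
  (i, s) != (j, t) -> p i s - p j t != 0.
Proof. by move=> h1 h2 h3; exact: (gen 0 h1 h2 h3). Qed.

Lemma Pwr_neq0 i s (m : int) : (0 < s <= a i)%N -> Pwr p i s (p i s + m%:~R) != 0.
Proof.
move=> si; rewrite prodf_seq_neq0; apply/allP => t; rewrite mem_index_iota => ti.
apply/implyP => ts; rewrite -addrA addrCA -(opprK m) rmorphN /= addrC subr_eq0.
by apply: gen => //; rewrite xpair_eqE eqxx eq_sym.
Qed.

Definition in_range i j r := forall k, (i <= k < j)%N -> (0 < r k <= a k)%N.

(** The exponential of f raises p_{i,r_i} by 1, so the shifted P_i has a zero at p_{i,r_i} + 1,
    exactly the pole of f. The index i-1 lies below the shifted range, so P_{i-1} is unchanged. *)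
Lemma term_fpoly al i r w : (0 < i)%N -> (i <= al)%N -> in_range i al r ->
  ((i < al)%N -> w - p i (r i) - 1 != 0) ->
  fval p al i r w * (Pw (shifted p i al r) i w / Pw (shifted p i al r) i.-1 (w - 1))
    = (fpoly p al i r).[w] / Pw p i.-1 (w - 1).
Proof.
move=> i0 ial rr w0; rewrite mulrA fpoly_horner //; congr (_ / _); last first.
  by apply: eq_Pw => t; rewrite /shifted (_ : (i <= i.-1)%N = false) ?addr0 //; lia.
rewrite /fval; case: ltnP w0 => lt w0.
  have {}w0 := w0 isT; have ri := rr i; rewrite (Pw_split _ _ (ri _)) ?leqnn //.
  rewrite {2}/shifted leqnn lt eqxx /= (eq_Pwr (p2 := p)).
    by rewrite opprD addrA; field.
  by move=> t tr; rewrite /shifted (negPf tr) andbF addr0.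
by rewrite mul1r; apply: eq_Pw => t; rewrite /shifted leqnn ltnNge lt addr0.
Qed.

(* Residue at [p_{i-1,s} + 1]. *)
Definition res_lower al be i r r' s :=
  (fpoly p al i r).[p i.-1 s + 1] * eval (shifted p i al r) i be r' (p i.-1 s + 1)
  / Pwr p i.-1 s (p i.-1 s).

(* Pole of the shifted [e_{i,be}]; junk when [i = be]. *)
Definition upper_pole al i r r' := shifted p i al r i (r' i).

(** The value 0 at [i = be] reflects that the diagonal entry of e is 1 and has no pole. *)
Definition res_upper al be i r r' :=
  let x := upper_pole al i r r' in
  if (i < be)%N then
    (fpoly p al i r).[x] * eres (shifted p i al r) i be r' / Pw p i.-1 (x - 1)
  else 0.

(** Peel the lowest factor off each product in [fres]. The numerator factor with k = i+1, or P_al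
    when al = i+1, is what [fpoly] for i+1 contributes at p_{i,r_i} + 1. *)
Lemma fres_rec al i r : (i < al)%N -> in_range i al r ->
  fres p al i r * Pwr p i (r i) (p i (r i)) = (fpoly p al i.+1 r).[p i (r i) + 1].
Proof.
move=> ial rr; have P0 : Pwr p i (r i) (p i (r i)) != 0.
  by have := Pwr_neq0 0 (rr i _); rewrite addr0; apply; rewrite leqnn ial.
rewrite fpoly_horner // /fres [X in _ / X]big_ltn // invfM mulrA mulrAC.
case: ltnP => lt.
  rewrite (@big_ltn _ _ _ i.+1) //=; move: (\prod_(_ <= k < _) _) (\prod_(_ <= k < _) _) => u v.
  move: (Pw _ _ _) (Pwr p i.+1 _ _) => x y; move: P0; move: (Pwr _ _ _ _) => c c0.
  by move: (u^-1) => u'; field.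
have -> : al = i.+1 by lia.
by rewrite !big_geq // invr1 !mulr1 mulfVK.
Qed.

(** The two shifts differ only at p_{i,r_i}. For be > i+1, the P_i in the numerator of e_{i+1,be}
    has one more factor than P_{i,r_i}, namely minus the denominator of [eval] at p_{i,r_i} + 1;
    their quotient gives the sign. For be = i+1 the sign is the one in [eres]. *)
Lemma eres_rec al be i r r' : (0 < i)%N -> (i < al)%N -> (i < be)%N ->
  in_range i al r -> in_range i be r' -> r i = r' i ->
  Pwr p i (r i) (p i (r i) + 1) * eres (shifted p i al r) i be r' =
  - Pw p i.-1 (p i (r i)) * eval (shifted p i.+1 al r) i.+1 be r' (p i (r i) + 1).
Proof.
move=> i0 ial ibe rr rr' e.
set q := shifted p i al r; set q' := shifted p i.+1 al r.
have P0 : Pwr p i (r i) (p i (r i) + 1) != 0.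
  by apply: (Pwr_neq0 1); apply: rr; lia.
have qi : q i (r' i) = p i (r i) + 1 by rewrite /q /shifted leqnn ial e eqxx.
have qlow t : q i.-1 t = p i.-1 t.
  by rewrite /q /shifted (_ : (i <= i.-1)%N = false) ?addr0 //; lia.
have q'i t : q' i t = p i t by rewrite /q' /shifted ltnn addr0.
have qup k t : (i < k)%N -> q k t = q' k t.
  by move=> ik; rewrite /q /q' /shifted ik (ltnW ik).
have qne t : t != r i -> q i t = p i t.
  by move=> tr; rewrite /q /shifted (negPf tr) andbF addr0.
rewrite /eres qi (eq_Pw _ qlow) addrK [X in _ / X]big_ltn // qi -e.
rewrite (eq_Pwr _ qne).
rewrite /eval; case: ltnP => lt; last first.
  have -> : be = i.+1 by lia.
  by rewrite /= !big_geq // !mulr1; field.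
rewrite /eres.
rewrite (@big_ltn _ _ _ i) /=; last lia.
rewrite -e (eq_Pwr _ qne) qup // (eq_Pw _ q'i).
rewrite (Pw_split _ _ (rr i _)) ?leqnn //.
rewrite (eq_big_nat _ _ (F2 := fun k => Pwr q' k (r' k) (q' k.+1 (r' k.+1) - 1))); last first.
  move=> k kk; rewrite qup; last lia.
  by apply: eq_Pwr => t _; apply: qup; lia.
have -> : \prod_(i.+1 <= k < be) Pwr q k (r' k) (q k (r' k)) =
    \prod_(i.+1 <= k < be) Pwr q' k (r' k) (q' k (r' k)).
  apply: eq_big_nat => k kk; rewrite qup; last lia.
  by apply: eq_Pwr => t _; apply: qup; lia.
(* Depending on whether r and r' agree at i+1, this is p_{i,r_i} - p_{i+1,r'_{i+1}} plus 0 or 1, so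
   genericity applies with m = 0 or m = -1. *)
have : p i (r i) + 1 - q' i.+1 (r' i.+1) != 0.
  have : (0 < r' i.+1 <= a i.+1)%N by apply: rr'; lia.
  have : (0 < r i <= a i)%N by apply: rr; lia.
  rewrite /q' /shifted; case: (_ && (_ == _)) => ri ri' /=.
    by rewrite opprD addrACA subrr addr0 gen0 // xpair_eqE; lia.
  by rewrite mulr0n addr0 addrAC -[1]opprK subr_eq0; apply: (gen (- 1)) => //; rewrite xpair_eqE; lia.
move: (q' _ _) => y; move: (\prod_(_ <= k < _) _) (\prod_(_ <= k < _) _) => u v.
move: (Pw _ _ _) (Pwr p i _ (y - 1)) => A B; move: P0; move: (Pwr _ _ _ _) => c c0 d0.
rewrite !invfM !mulrA; move: (u^-1) => u'.
by field; rewrite c0 d0.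
Qed.


(** The common pole is p_{i,r_i} + 1. By [fres_rec] and [eres_rec] the two residues agree up to sign
    once P_{i-1}(p_{i,r_i}), the denominator of g_i there, is cancelled. *)
Lemma res_upper_eq al be i r r' : (0 < i)%N -> (i < al)%N -> (i < be)%N ->
  in_range i al r -> in_range i be r' -> r i = r' i ->
  res_upper al be i r r' = - res_lower al be i.+1 r r' (r i).
Proof.
move=> i0 ial ibe rr rr' e.
have rri : (0 < r i <= a i)%N by apply: rr; rewrite leqnn.
have x_eq : upper_pole al i r r' = p i (r i) + 1.
  by rewrite /upper_pole /shifted leqnn ial -e eqxx.
rewrite /res_upper /res_lower ibe x_eq addrK fpoly_horner ?(ltnW ial) // ial -fres_rec //.
have := eres_rec i0 ial ibe rr rr' e.
have := Pwr_neq0 0 rri; rewrite addr0.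
have : Pw p i.-1 (p i (r i)) != 0.
  rewrite prodf_seq_neq0; apply/allP => t; rewrite mem_index_iota => ti /=.
  by apply: gen0 => //; rewrite xpair_eqE; lia.
move: (Pw _ _ _) (Pwr _ _ _ _) (Pwr _ _ _ _) => A B C A0 C0 E.
rewrite -[_ * B * _]mulrA E; field.
by rewrite A0 C0.
Qed.

(** The pole is the unshifted p_{i,r'_i}, a root of [fpoly]: for i < al the only missing factor
    belongs to r_i, and for i = al none is missing. *)
Lemma res_upper_neq al be i r r' : (0 < i)%N -> (i <= al)%N ->
  in_range i al r -> in_range i be r' -> (i < al -> r i != r' i)%N ->
  res_upper al be i r r' = 0.
Proof.
move=> i0 ial rr rr' ne; rewrite /res_upper; case: ltnP => // ibe.
rewrite [(fpoly _ _ _ _).[_]](_ : _ = 0) ?mul0r // fpoly_horner // /upper_pole /shifted.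
have ri' : (0 < r' i <= a i)%N by apply: rr'; rewrite leqnn.
case: ltnP ne => lt ne; last first.
  by rewrite andbF addr0 (Pw_split _ _ ri') subrr mulr0.
rewrite leqnn eq_sym (negPf (ne isT)) /= addr0.
apply/eqP; rewrite mulf_eq0; apply/orP; right.
rewrite prodf_seq_eq0; apply/hasP; exists (r' i); first by rewrite mem_index_iota; lia.
by rewrite eq_sym (ne isT) subrr eqxx.
Qed.

Lemma res_lower_congr al be i r1 r1' r2 r2' s :
  (forall k, (i <= k)%N -> r1 k = r2 k) -> (forall k, (i <= k)%N -> r1' k = r2' k) ->
  res_lower al be i r1 r1' s = res_lower al be i r2 r2' s.
Proof.
move=> e e'; rewrite /res_lower (fpoly_eq _ _ e) (eval_eq _ _ e' (p2 := shifted p i al r2)) //.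
by move=> k t _; apply: shifted_eq.
Qed.

(** The weight [h] serves two purposes: 1/(z - x) recovers the polar part of a summand, and the
    constant 1 its coefficient of 1/z. *)
Definition sum_poles al be i r r' (h : L -> L) :=
  \sum_(1 <= s < (a i.-1).+1) res_lower al be i r r' s * h (p i.-1 s + 1)
  + res_upper al be i r r' * h (upper_pole al i r r').

Definition lower_poles i := [seq p i.-1 s + 1 | s <- index_iota 1 (a i.-1).+1].
Definition poles al be i r r' :=
  if (i < be)%N then upper_pole al i r r' :: lower_poles i else lower_poles i.

Lemma size_poles al be i r r' : size (poles al be i r r') = (a i.-1 + (i < be))%N.
Proof. by rewrite /poles; case: ifP => _; rewrite /= size_map size_iota subn1 ?addn1 ?addn0. Qed.

Lemma lower_poles_inj i :
  {in index_iota 1 (a i.-1).+1 &, injective (fun s => p i.-1 s + 1)}.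
Proof.
move=> s t; rewrite !mem_index_iota => hs ht /addIr E; apply/eqP; apply: contraT => st.
have : p i.-1 s - p i.-1 t != 0 by apply: gen0 => //; rewrite xpair_eqE eqxx.
by rewrite E subrr eqxx.
Qed.

Lemma upper_notin_lower al be i r r' : (0 < i)%N -> (i < be)%N -> in_range i be r' ->
  upper_pole al i r r' \notin lower_poles i.
Proof.
move=> i0 ibe rr'; apply/mapP => -[s]; rewrite mem_index_iota => si E.
have ri' : (0 < r' i <= a i)%N by apply: rr'; rewrite leqnn.
have ne : (i, r' i) != (i.-1, s) by rewrite xpair_eqE; lia.
move: E; rewrite /upper_pole /shifted; case: (_ && (_ == _)) => /=.
  by move/addIr => E; have := gen0 ri' si ne; rewrite E subrr eqxx.
by rewrite addr0 => E; have := gen 1 ri' si ne; rewrite E addrAC subrr add0r eqxx.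
Qed.

Lemma poles_uniq al be i r r' : (0 < i)%N -> in_range i be r' ->
  uniq (poles al be i r r').
Proof.
move=> i0 rr'; have U : uniq (lower_poles i).
  by rewrite map_inj_in_uniq ?iota_uniq //; apply: lower_poles_inj.
rewrite /poles; case: ltnP => //= ibe.
by rewrite U (upper_notin_lower _ _ _ ibe).
Qed.

Lemma prod_lower_poles i w : \prod_(x <- lower_poles i) (w - x) = Pw p i.-1 (w - 1).
Proof. by rewrite big_map; apply: eq_bigr => t _; rewrite opprD addrA addrAC. Qed.

Lemma prod_lower_poles_but i s : (0 < s <= a i.-1)%N ->
  \prod_(x <- lower_poles i | x != p i.-1 s + 1) (p i.-1 s + 1 - x) =
  Pwr p i.-1 s (p i.-1 s).
Proof.
move=> si; rewrite big_map /Pwr [LHS]big_seq_cond [RHS]big_seq_cond; apply: eq_big => [t|t _]; last first.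
  by rewrite opprD addrACA subrr addr0.
case: (boolP (t \in _)) => //= ti; apply/esym.
by rewrite -(inj_in_eq (@lower_poles_inj i)) // mem_index_iota; lia.
Qed.

(** Numerator of the i-th summand over the product of z - x for x in [poles]. *)
Definition numer al be i r r' : {poly L} :=
  if (i < be)%N then eres (shifted p i al r) i be r' *: fpoly p al i r else fpoly p al i r.

Lemma sum_poles_seq al be i r r' h : (0 < i)%N -> in_range i be r' ->
  \sum_(x <- poles al be i r r')
     (numer al be i r r').[x] / \prod_(y <- poles al be i r r' | y != x) (x - y) * h x
  = sum_poles al be i r r' h.
Proof.
move=> i0 rr'; rewrite /sum_poles /poles /numer /res_upper; case: ltnP => ibe; last first.
  rewrite mul0r addr0 [LHS]big_map; apply: eq_big_nat => s si; congr (_ * _).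
  by rewrite prod_lower_poles_but // /res_lower /eval ltnNge ibe mulr1.
have nin := upper_notin_lower al r i0 ibe rr'.
rewrite big_cons addrC; congr (_ + _ * _).
  rewrite [LHS]big_map; apply: eq_big_nat => s si; congr (_ * _).
  rewrite big_cons [X in if X then _ else _](_ : _ = true); last first.
    apply: contraNneq nin => ->; apply/mapP; exists s => //.
    by rewrite mem_index_iota; lia.
  rewrite prod_lower_poles_but // /res_lower /eval ibe hornerZ invfM.
  by rewrite -/(upper_pole al i r r') !mulrA; congr (_ / _); rewrite [LHS]mulrAC mulrC !mulrA.
rewrite big_cons eqxx /= hornerZ [eres _ _ _ _ * _]mulrC -prod_lower_poles; congr (_ / _).
rewrite [LHS]big_seq_cond [RHS]big_seq_cond; apply: eq_bigl => x.
by case: (boolP (x \in _)) => //= xin; apply: contraNneq nin => <-.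
Qed.

(** The size hypothesis says that the degree does not exceed the number of poles, so the polynomial
    part is a constant. *)
Lemma term_partial_fractions al be i r r' z : (0 < i)%N -> (i <= al)%N ->
  in_range i al r -> in_range i be r' -> ((i < al)%N -> z - p i (r i) - 1 != 0) ->
  z \notin poles al be i r r' ->
  (size (numer al be i r r') <= (a i.-1 + (i < be)).+1)%N ->
  fval p al i r z * (Pw (shifted p i al r) i z / Pw (shifted p i al r) i.-1 (z - 1))
    * eval (shifted p i al r) i be r' z
  = (numer al be i r r')`_(a i.-1 + (i < be)) + sum_poles al be i r r' (fun x => (z - x)^-1).
Proof.
move=> i0 ial rr rr' z0 zn sz; rewrite term_fpoly // -sum_poles_seq //.
rewrite -(size_poles al be i r r') in sz *.
rewrite -(partial_fractions (poles_uniq _ _ i0 rr') sz zn) /poles /numer /eval.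
case: ltnP => ibe; last by rewrite mulr1 prod_lower_poles.
rewrite big_cons prod_lower_poles hornerZ -/(upper_pole al i r r') mulf_div.
by rewrite [_ * eres _ _ _ _]mulrC [Pw _ _ _ * _]mulrC.
Qed.

Lemma numer_residues al be i r r' : (0 < i)%N -> in_range i be r' ->
  (size (numer al be i r r') <= a i.-1 + (i < be))%N ->
  (numer al be i r r')`_(a i.-1 + (i < be)).-1 = sum_poles al be i r r' (fun=> 1).
Proof.
move=> i0 rr' sz; rewrite -sum_poles_seq //.
rewrite -(size_poles al be i r r') in sz *.
rewrite (sum_residues (poles_uniq _ _ i0 rr') sz).
by apply: eq_bigr => x _; rewrite mulr1.
Qed.

End Generic.
End Coefficients.

(** * Sums over selections *)

Section Tuples.
Variables (rr ss : nat).
Local Notation n := (nn rr ss).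
Local Notation a := (aa rr ss).
Local Notation tuples := {ffun 'I_n -> 'I_n}.

Lemma aa_le i : (i <= n)%N -> (a i <= n)%N.
Proof. rewrite /aa /nn; case: ifP => [|_]; first lia; case: ifP; lia. Qed.

(** Sets the selection r_i to t; the stored value is one less, as [rsel] adds 1. *)
Definition set_entry (rho : tuples) (i t : nat) : tuples :=
  [ffun k : 'I_n => if k == i :> nat then insubd k t.-1 else rho k].

Lemma rsel_set_entry_neq rho i t k : k != i -> rsel (set_entry rho i t) k = rsel rho k.
Proof.
rewrite /rsel; case: insubP => //= u _ uk ki.
by rewrite ffunE uk (negPf ki).
Qed.

Lemma rsel_set_entry rho i t : (i < n)%N -> (0 < t <= n)%N -> rsel (set_entry rho i t) i = t.
Proof.
move=> iN tN; rewrite /rsel insubT /= ffunE eqxx val_insubd; case: ifP; lia.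
Qed.

Lemma rsel_valid i j (rho : tuples) k : valid i j rho -> (i <= k < j)%N -> (k < n)%N ->
  (0 < rsel rho k <= a k)%N.
Proof.
move=> /forallP V kij kn; have := V (Ordinal kn); rewrite /= kij.
by rewrite /rsel insubT /=; congr is_true; congr (_ < _)%N; congr (nat_of_ord (rho _)); apply: val_inj.
Qed.

Lemma valid_set_entry i j (rho : tuples) t : (i < j)%N -> (i < n)%N -> (0 < t <= a i)%N ->
  valid i.+1 j rho -> valid i j (set_entry rho i t).
Proof.
move=> ij iN ta /forallP V; apply/forallP => k; have := V k.
have aN := aa_le (ltnW iN).
rewrite ffunE; case: (eqVneq (k : nat) i) => [->|ki].
  by rewrite /= leqnn ij ltnn /= => _; rewrite val_insubd; case: ifP; lia.
by rewrite (_ : (i <= k)%N = (i < k)%N) //; lia.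
Qed.

Lemma set_entry_valid i j (rho : tuples) : (i < j)%N -> (i < n)%N -> valid i j rho ->
  valid i.+1 j (set_entry rho i 1).
Proof.
move=> ij iN /forallP V; apply/forallP => k; have := V k.
rewrite ffunE; case: (eqVneq (k : nat) i) => [->|ki].
  by rewrite ltnn /= => _; rewrite val_insubd (leq_ltn_trans _ iN).
by rewrite (_ : (i <= k)%N = (i < k)%N) //; lia.
Qed.

Lemma valid_entry i j (rho : tuples) (k : 'I_n) : valid i j rho -> ~~ (i <= k < j)%N -> rho k = 0%N :> nat.
Proof. by move=> /forallP/(_ k) V /negPf kij; move: V; rewrite kij => /eqP. Qed.

(** Separates the choice of r_i from the tail (r_k) with k > i, which the passage from summand i to
    summand i+1 requires. *)
Lemma big_valid_split (V : nmodType) i j (F : tuples -> V) : (i < j)%N -> (i < n)%N ->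
  \sum_(rho | valid i j rho) F rho =
  \sum_(rho | valid i.+1 j rho) \sum_(1 <= t < (a i).+1) F (set_entry rho i t).
Proof.
move=> ij iN; pose o := Ordinal iN.
have aN := aa_le (ltnW iN).
(* Entry 1 is stored as 0, the value that [valid] imposes outside the range; resetting position i
   therefore projects a selection onto its tail. *)
rewrite (partition_big (fun rho => set_entry rho i 1) (valid i.+1 j)) /=; last first.
  by move=> rho; apply: set_entry_valid.
apply: eq_bigr => rho V0.
rewrite (reindex_onto (fun t : 'I_n => set_entry rho i t.+1) (fun s => s o)) /=; last first.
  move=> s /andP[Vs /eqP <-]; apply/ffunP => k; rewrite !ffunE; case: eqP => // ki.
  have -> : k = o by apply: val_inj.
  by apply: val_inj; rewrite val_insubd /= ltn_ord.
rewrite big_add1 big_mkord /= (big_ord_widen _ (fun t => F (set_entry rho i t.+1)) aN).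
rewrite [RHS]big_mkcond [LHS]big_mkcond; apply: eq_bigr => t _.
have -> : set_entry (set_entry rho i t.+1) i 1 == rho.
  apply/eqP/ffunP => k; rewrite !ffunE; case: eqP => // ki; apply: val_inj.
  by rewrite val_insubd (leq_ltn_trans (leq0n k) (ltn_ord k)) /= (valid_entry V0) // ki ltnn.
have -> : set_entry rho i t.+1 o == t.
  by rewrite ffunE /= eqxx -val_eqE val_insubd /= ltn_ord.
rewrite !andbT; case: ltnP => ta; first by rewrite valid_set_entry.
case: ifP => // /forallP/(_ o); rewrite /= leqnn ij ffunE eqxx val_insubd ltn_ord /=.
by rewrite ltnNge ta.
Qed.

End Tuples.

(** * Telescoping of the weighted residues over the summands *)

Section Telescoping.
Variables (L : fieldType) (rr ss : nat) (p : nat -> nat -> L).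
Local Notation n := (nn rr ss).
Local Notation a := (aa rr ss).
Local Notation tuples := {ffun 'I_n -> 'I_n}.
Hypothesis gen : forall i s j t (m : int), (0 < s <= a i)%N -> (0 < t <= a j)%N ->
  (i, s) != (j, t) -> p i s - p j t != m%:~R.

Lemma valid_in_range i j (rho : tuples) : (j <= n)%N -> valid i j rho ->
  in_range a i j (rsel rho).
Proof.
move=> jn V k kij; apply: (rsel_valid V kij).
by case/andP: kij => _ kj; apply: leq_trans kj jn.
Qed.

(** Split each summand into its poles p_{i-1,s} + 1 ([lo]) and its shifted pole ([up]). Then
    [up i = - lo i.+1] and both ends vanish. The condition on [G] says that equal choices r_i = r'_i
    do not affect the weight. *)
Lemma sum_poles_telescope al be (h : L -> L) (G : nat -> tuples -> tuples -> L) :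
  (al <= n)%N -> (be <= n)%N ->
  (forall i t rho rho', (i < al)%N -> (i < be)%N -> (0 < t <= a i)%N ->
    G i (set_entry rho i t) (set_entry rho' i t) = G i.+1 rho rho') ->
  \sum_(1 <= i < (minn al be).+1) \sum_(rho : tuples | valid i al rho)
    \sum_(rho' : tuples | valid i be rho')
      G i rho rho' * sum_poles a p al be i (rsel rho) (rsel rho') h = 0.
Proof.
move=> aln ben Gstep.
have [->|m0] := posnP (minn al be); first by rewrite big_geq.
pose lo i := \sum_(rho : tuples | valid i al rho) \sum_(rho' : tuples | valid i be rho')
  G i rho rho' * \sum_(1 <= s < (a i.-1).+1)
    res_lower a p al be i (rsel rho) (rsel rho') s * h (p i.-1 s + 1).
pose up i := \sum_(rho : tuples | valid i al rho) \sum_(rho' : tuples | valid i be rho')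
  G i rho rho' * (res_upper a p al be i (rsel rho) (rsel rho') *
                  h (upper_pole p al i (rsel rho) (rsel rho'))).
(* There are no lower poles at i = 1 because a_0 = 0. *)
have lo1 : lo 1%N = 0.
  rewrite /lo big1 // => rho _; rewrite big1 // => rho' _.
  by rewrite big_geq ?mulr0.
have up_last : up (minn al be) = 0.
  rewrite /up big1 // => rho V; rewrite big1 // => rho' V'.
  have R := valid_in_range aln V; have R' := valid_in_range ben V'.
  case: (ltnP (minn al be) be) => lt.
    by rewrite (res_upper_neq p m0 _ R R') ?mul0r ?mulr0 ?geq_minl //; lia.
  by rewrite /res_upper ltnNge lt /= mul0r mulr0.
have upE i : (0 < i < minn al be)%N -> up i = - lo i.+1.
  move=> im; have [i0 ial ibe iN] : [/\ (0 < i)%N, (i < al)%N, (i < be)%N & (i < n)%N].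
    by split; lia.
  rewrite /up big_valid_split // /lo -sumrN; apply: eq_bigr => rho V.
  under eq_bigr do rewrite big_valid_split //.
  rewrite exchange_big /= -sumrN; apply: eq_bigr => rho' V'.
  rewrite mulr_sumr -sumrN; apply: eq_big_nat => t ti.
  have ta : (0 < t <= a i)%N by lia.
  have tn : (0 < t <= n)%N by have := aa_le (ltnW iN); lia.
  have R u : (0 < u <= a i)%N -> in_range a i al (rsel (set_entry rho i u)).
    by move=> ui; apply: valid_in_range => //; apply: valid_set_entry.
  have R' u : (0 < u <= a i)%N -> in_range a i be (rsel (set_entry rho' i u)).
    by move=> ui; apply: valid_in_range => //; apply: valid_set_entry.
  (* Only r'_i = r_i = t survives; t then plays the role of the lower pole index s of summand
     i+1. *)
  rewrite (bigD1_seq t) ?iota_uniq ?mem_index_iota //= big1_seq ?addr0; last first.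
    move=> u /andP[ut]; rewrite mem_index_iota => ui.
    have un : (0 < u <= n)%N by have := aa_le (ltnW iN); lia.
    rewrite (res_upper_neq p i0 (ltnW ial) (R _ ta) (R' u _)) ?mul0r ?mulr0 // !rsel_set_entry //.
    by rewrite eq_sym.
  rewrite Gstep // (res_upper_eq gen i0 ial ibe (R _ ta) (R' _ ta)) ?rsel_set_entry //.
  rewrite /upper_pole /shifted !rsel_set_entry // leqnn ial eqxx /=.
  rewrite mulNr mulrN; congr (- (_ * (_ * _))).
  by apply: res_lower_congr => k ik; rewrite rsel_set_entry_neq //; lia.
transitivity (\sum_(1 <= i < (minn al be).+1) (lo i + up i)).
  apply: eq_bigr => i _; rewrite /lo /up -big_split /=; apply: eq_bigr => rho _.
  by rewrite -big_split /=; apply: eq_bigr => rho' _; rewrite -mulrDr.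
rewrite big_nat_recr //= up_last addr0.
rewrite (eq_big_nat _ _ (F2 := fun i => - (lo i.+1 - lo i))); last first.
  by move=> i im; rewrite upE // opprB.
by rewrite sumrN telescope_sumr // lo1 subr0 addNr.
Qed.

End Telescoping.

(** * The shift automorphisms *)

Lemma frac_repr (A : idomainType) (x : {fraction A}) :
  x = (\n_(repr x))%:F / (\d_(repr x))%:F.
Proof.
have dn0 : (\d_(repr x))%:F != 0 :> {fraction A} by rewrite tofrac_eq0 denom_ratioP.
apply: (mulIf dn0); rewrite mulfVK //; unlock FracField.tofrac.
rewrite -[x in LHS]reprK -[LHS]FracField.pi_mul.
apply/eqmodP; rewrite /= FracField.equivfE /FracField.mulf.
by rewrite !numden_Ratio ?(oner_eq0, mulf_neq0, denom_ratioP) // !mulr1 mulrC reprK.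
Qed.

Section FracLift.
Variables (A B : idomainType) (f : {rmorphism A -> B}).
Hypothesis f_inj : injective f.

(** Has the shape of [shiftF], so that its morphism properties hold for [shiftF] by conversion. *)
Definition frac_lift (x : {fraction A}) : {fraction B} :=
  (f \n_(repr x))%:F / (f \d_(repr x))%:F.

Lemma frac_lift_neq0 a : a != 0 -> (f a)%:F != 0 :> {fraction B}.
Proof. by rewrite tofrac_eq0 -(rmorph0 f) (inj_eq f_inj). Qed.

(** Independence of the chosen representative: the cross-multiplied identity is mapped by [f], and
    injectivity keeps denominators nonzero. *)
Lemma frac_liftE a b : b != 0 ->
  frac_lift (a%:F / b%:F) = (f a)%:F / (f b)%:F.
Proof.
move=> b0; rewrite /frac_lift; pose x := a%:F / b%:F; rewrite -/x.
have := frac_repr x; rewrite {1}/x => /eqP.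
have d0 : \d_(repr x) != 0 by exact: denom_ratioP.
rewrite eqr_div ?tofrac_eq0 // -!tofracM tofrac_eq => /eqP/(congr1 f).
rewrite !rmorphM => E.
apply/eqP; rewrite eqr_div ?frac_lift_neq0 // -!tofracM tofrac_eq -E.
by apply/eqP.
Qed.

Lemma frac_lift_zmod : zmod_morphism frac_lift.
Proof.
move=> x y; rewrite (frac_repr x) (frac_repr y).
set a := \n_ _; set b := \d_(repr x); set c := \n_(repr y); set d := \d_(repr y).
have b0 : b != 0 by exact: denom_ratioP.
have d0 : d != 0 by exact: denom_ratioP.
rewrite -mulNr addf_div ?tofrac_eq0 // -!(tofracM, tofracN, tofracD) !frac_liftE ?mulf_neq0 //.
rewrite -mulNr addf_div ?frac_lift_neq0 // -!(tofracM, tofracN, tofracD).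
by rewrite !(rmorphD, rmorphN, rmorphM).
Qed.

Lemma frac_lift_monoid : monoid_morphism frac_lift.
Proof.
split.
  by rewrite -[1](divr1) -tofrac1 frac_liftE ?oner_neq0 // rmorph1 divff // tofrac_eq0 oner_neq0.
move=> x y; rewrite (frac_repr x) (frac_repr y).
set a := \n_ _; set b := \d_(repr x); set c := \n_(repr y); set d := \d_(repr y).
have b0 : b != 0 by exact: denom_ratioP.
have d0 : d != 0 by exact: denom_ratioP.
by rewrite mulf_div -!tofracM !frac_liftE ?mulf_neq0 // mulf_div -!tofracM !rmorphM.
Qed.

Lemma frac_lift_tofrac a : frac_lift a%:F = (f a)%:F.
Proof. by rewrite -[a%:F]divr1 -tofrac1 frac_liftE ?oner_neq0 // rmorph1 tofrac1 divr1. Qed.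

End FracLift.

Section Shift.
Variables (R : realType) (rr ss : nat).
Local Notation Pol := (Pol R rr ss).
Local Notation Fld := (Fld R rr ss).
Local Notation Ex := (Ex rr ss).

(** The shift by [- m] is a left inverse, as one checks on the variables. *)
Lemma shiftP_inj (m : Ex) : injective (@shiftP R rr ss m).
Proof.
apply: (can_inj (g := shiftP (- m))) => p.
elim/mpolyind: p => [|c k p _ _ IH]; first by rewrite /shiftP !mmap0.
rewrite /shiftP !mmapD; congr (_ + _); last exact: IH.
rewrite !mmapZ !mmapX rmorphM /= mmapC -mul_mpolyC; congr (_ * _).
rewrite /mmap1 rmorph_prod /= -mmap1_id /mmap1; apply: eq_bigr => i _.
rewrite rmorphXn /=; congr (_ ^+ _).
case: ifP => iz; first by rewrite mmapX mmap1U iz.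
rewrite rmorphB /= mmapX mmap1U iz rmorph_int.
by rewrite ffunE rmorphN /= opprK addrK.
Qed.

HB.instance Definition _ (m : Ex) := GRing.RMorphism.copy (@shiftP R rr ss m)
  (mmap (@mpolyC (NV rr ss) R[i]) (fun j => if j == zidx rr ss then 'X_j else 'X_j - (m j)%:~R)).

HB.instance Definition _ (m : Ex) := GRing.isZmodMorphism.Build Fld Fld (@shiftF R rr ss m)
  (frac_lift_zmod (@shiftP_inj m)).
HB.instance Definition _ (m : Ex) := GRing.isMonoidMorphism.Build Fld Fld (@shiftF R rr ss m)
  (frac_lift_monoid (@shiftP_inj m)).

Lemma shiftF_tofrac (m : Ex) (a : Pol) : shiftF m a%:F = (shiftP m a)%:F.
Proof. exact: (frac_lift_tofrac (@shiftP_inj m)). Qed.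

Lemma shiftF_zv (m : Ex) : shiftF m (zv R rr ss) = zv R rr ss.
Proof. by rewrite /zv shiftF_tofrac /shiftP mmapX mmap1U eqxx. Qed.

Lemma shiftF_pv (m : Ex) i t : pidx rr ss i t != zidx rr ss ->
  shiftF m (pv R rr ss i t) = pv R rr ss i t - (m (pidx rr ss i t))%:~R.
Proof.
by move=> h; rewrite /pv shiftF_tofrac /shiftP mmapX mmap1U (negPf h) tofracB rmorph_int.
Qed.

End Shift.

(** * z-free and generic elements *)

Section Morphism.
Variables (L : fieldType) (a : nat -> nat) (f : {rmorphism L -> L}).
Variables (p q : nat -> nat -> L).
Hypothesis fpq : forall k t, (0 < t <= a k)%N -> f (p k t) = q k t.

Lemma Pw_morph j w : f (Pw a p j w) = Pw a q j (f w).
Proof. by rewrite rmorph_prod; apply: eq_big_nat => t tj; rewrite rmorphB fpq //. Qed.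

Lemma Pwr_morph j s w : f (Pwr a p j s w) = Pwr a q j s (f w).
Proof.
rewrite rmorph_prod /Pwr big_seq_cond [RHS]big_seq_cond; apply: eq_bigr => t.
by rewrite mem_index_iota => /andP[tj _]; rewrite rmorphB fpq //; lia.
Qed.

Lemma eres_morph i be r : (i < be)%N -> in_range a i be r ->
  f (eres a p i be r) = eres a q i be r.
Proof.
move=> ibe rr; rewrite /eres fmorph_div rmorphN rmorphM Pw_morph rmorphB rmorph1 fpq; last first.
  by apply: rr; rewrite leqnn.
rewrite !rmorph_prod; congr (- (_ * _) / _); apply: eq_big_nat => k kk.
  by rewrite Pwr_morph rmorphB rmorph1 fpq //; apply: rr; lia.
by rewrite Pwr_morph fpq //; apply: rr; lia.
Qed.

Lemma eval_morph i be r w : in_range a i be r -> f w = w ->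
  f (eval a p i be r w) = eval a q i be r w.
Proof.
move=> rr fw; rewrite /eval; case: ltnP => ibe; last by rewrite rmorph1.
by rewrite fmorph_div rmorphB fw eres_morph // fpq //; apply: rr; rewrite leqnn.
Qed.
End Morphism.

Section ZFree.
Variables (R : realType) (rr ss : nat).
Local Notation n := (nn rr ss).
Local Notation a := (aa rr ss).
Local Notation zidx := (zidx rr ss).
Implicit Types (x y : Fld R rr ss) (u v : Pol R rr ss).

Lemma zfree_polyD u v : zfree_poly u -> zfree_poly v -> zfree_poly (u + v).
Proof. by move=> hu hv m /msuppD_le; rewrite mem_cat => /orP[/hu|/hv]. Qed.

Lemma zfree_polyN u : zfree_poly u -> zfree_poly (- u).
Proof. by move=> hu m; rewrite (perm_mem (msuppN _)) => /hu. Qed.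

Lemma zfree_polyM u v : zfree_poly u -> zfree_poly v -> zfree_poly (u * v).
Proof.
move=> hu hv m /msuppM_le /allpairsP[[m1 m2] /= [/hu e1 /hv e2 ->]].
by rewrite mnmDE e1 e2.
Qed.

Lemma zfree_polyC c : zfree_poly (c%:MP : Pol R rr ss).
Proof.
by move=> m; rewrite msuppC; case: eqP => // _; rewrite inE => /eqP ->; rewrite mnm0E.
Qed.

Lemma zfree_tofrac u : zfree_poly u -> zfree (u%:F : Fld R rr ss).
Proof.
move=> hu; exists u, 1; split=> //; rewrite ?oner_neq0 ?tofrac1 ?divr1 //.
by rewrite -mpolyC1; apply: zfree_polyC.
Qed.

Lemma zfreeD x y : zfree x -> zfree y -> zfree (x + y).
Proof.
move=> [u [v [hu hv v0 ->]]] [u' [v' [hu' hv' v0' ->]]].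
exists (u * v' + u' * v), (v * v'); split; rewrite ?mulf_neq0 //.
- by apply: zfree_polyD; apply: zfree_polyM.
- exact: zfree_polyM.
by rewrite addf_div ?tofrac_eq0 // -!(tofracM, tofracD).
Qed.

Lemma zfreeN x : zfree x -> zfree (- x).
Proof.
move=> [u [v [hu hv v0 ->]]]; exists (- u), v; split; rewrite ?tofracN ?mulNr //.
exact: zfree_polyN.
Qed.

Lemma zfreeM x y : zfree x -> zfree y -> zfree (x * y).
Proof.
move=> [u [v [hu hv v0 ->]]] [u' [v' [hu' hv' v0' ->]]].
exists (u * u'), (v * v'); split; rewrite ?mulf_neq0 //; try exact: zfree_polyM.
by rewrite mulf_div -!tofracM.
Qed.

Lemma zfree0 : zfree (0 : Fld R rr ss).
Proof. by rewrite -tofrac0; apply: zfree_tofrac; rewrite -mpolyC0; apply: zfree_polyC. Qed.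

Lemma zfree1 : zfree (1 : Fld R rr ss).
Proof. by rewrite -tofrac1; apply: zfree_tofrac; rewrite -mpolyC1; apply: zfree_polyC. Qed.

Lemma zfreeV x : zfree x -> zfree x^-1.
Proof.
move=> [u [v [hu hv v0 ->]]]; have [->|u0] := eqVneq u 0.
  by rewrite tofrac0 mul0r invr0; apply: zfree0.
by exists v, u; split=> //; rewrite invf_div.
Qed.

Lemma zfree_sum (I : Type) (s : seq I) (P : pred I) (F : I -> Fld R rr ss) :
  (forall i, P i -> zfree (F i)) -> zfree (\sum_(i <- s | P i) F i).
Proof. by move=> h; apply: big_ind => //; [apply: zfree0|apply: zfreeD]. Qed.

Lemma zfree_prod (I : Type) (s : seq I) (P : pred I) (F : I -> Fld R rr ss) :
  (forall i, P i -> zfree (F i)) -> zfree (\prod_(i <- s | P i) F i).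
Proof. by move=> h; apply: big_ind => //; [apply: zfree1|apply: zfreeM]. Qed.

Lemma pidx_val k t : (k < n)%N -> (0 < t <= n)%N -> pidx rr ss k t = (k * n + t.-1)%N :> nat.
Proof.
move=> kn tn; rewrite /pidx inordK // /NV.
by have := leq_mul kn (leqnn n); rewrite mulSn; lia.
Qed.

Lemma zidx_val : zidx = (n * n)%N :> nat.
Proof. by rewrite /Defs.zidx inordK. Qed.

(** [aa] vanishes at 0 and from n on, so a nonempty range of t confines k. *)
Lemma a_range k t : (0 < t <= a k)%N -> [/\ (0 < k)%N, (k < n)%N & (0 < t <= n)%N].
Proof.
rewrite /aa /nn; have [h1|h1] := leqP k rr; first by move=> h; split; lia.
have [h2|h2] := leqP k (rr + ss); move=> h; split; lia.
Qed.

Lemma pidx_neq_z k t : (0 < t <= a k)%N -> pidx rr ss k t != zidx.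
Proof.
case/a_range => _ kn tn; rewrite -val_eqE /= zidx_val pidx_val //.
by have := leq_mul kn (leqnn n); rewrite mulSn; lia.
Qed.

(** k and t-1 are the quotient and the remainder of the variable index modulo n. *)
Lemma pidx_eq k t k' t' : (0 < t <= a k)%N -> (0 < t' <= a k')%N ->
  (pidx rr ss k t == pidx rr ss k' t') = (k == k') && (t == t').
Proof.
case/a_range => _ kn tn; case/a_range => _ kn' tn'.
apply/eqP/andP => [|[/eqP-> /eqP-> //]] /(congr1 (@nat_of_ord _)).
rewrite !pidx_val // => E.
have e : k = k'.
  move: (congr1 (divn^~ n) E); rewrite /= !divnMDl ?(leq_ltn_trans _ kn) //.
  by rewrite !divn_small ?addn0; lia.
by rewrite e; split=> //; apply/eqP; move: E; rewrite e; lia.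
Qed.

Lemma zfree_pv k t : (0 < t <= a k)%N -> zfree (pv R rr ss k t).
Proof.
move=> ta; apply: zfree_tofrac => m; rewrite msuppX inE => /eqP ->.
by rewrite mnm1E (negPf (pidx_neq_z ta)).
Qed.

(** The coefficient of X_i in X_i - X_j - m is 1. *)
Lemma X_sub_int_neq0 (i j : 'I_(NV rr ss)) (m : int) : i != j ->
  ('X_i : Pol R rr ss)%:F - ('X_j : Pol R rr ss)%:F != m%:~R.
Proof.
move=> ij; rewrite -subr_eq0 -(rmorph_int (@FracField.tofrac (Pol R rr ss))) -!tofracB tofrac_eq0.
apply/negP => /eqP/(congr1 (mcoeff U_(i))).
rewrite !mcoeffB mcoeff0 !mcoeffXU eqxx eq_sym (negPf ij) subr0.
rewrite -(rmorph_int (@mpolyC (NV rr ss) R[i])) mcoeffC mnm1_eq0 mulr0 subr0.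
by move/eqP; rewrite oner_eq0.
Qed.

Lemma pv_gen i s j t (m : int) : (0 < s <= a i)%N -> (0 < t <= a j)%N ->
  (i, s) != (j, t) -> pv R rr ss i s - pv R rr ss j t != m%:~R.
Proof. by move=> h1 h2 h3; apply: X_sub_int_neq0; rewrite pidx_eq. Qed.

Lemma zv_gen i s (m : int) : (0 < s <= a i)%N -> zv R rr ss - pv R rr ss i s != m%:~R.
Proof. by move=> h; apply: X_sub_int_neq0; rewrite eq_sym pidx_neq_z. Qed.

Lemma zfree_Pw j w : zfree w -> zfree (Pw a (pv R rr ss) j w).
Proof.
move=> hw; rewrite /Pw big_seq_cond; apply: zfree_prod => t.
by rewrite mem_index_iota andbT => tj; apply: zfreeD => //; apply/zfreeN/zfree_pv; lia.
Qed.

Lemma zfree_Pwr j s w : zfree w -> zfree (Pwr a (pv R rr ss) j s w).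
Proof.
move=> hw; rewrite /Pwr big_seq_cond; apply: zfree_prod => t.
by rewrite mem_index_iota => /andP[tj _]; apply: zfreeD => //; apply/zfreeN/zfree_pv; lia.
Qed.

Lemma zfree_fres al i r : (i < al)%N -> in_range a i al r ->
  zfree (fres a (pv R rr ss) al i r).
Proof.
move=> ial rg; apply: zfreeM.
  apply: zfreeM.
    by apply/zfree_Pw/zfreeD; [apply/zfree_pv/rg; lia|apply: zfree1].
  rewrite big_seq_cond; apply: zfree_prod => k; rewrite mem_index_iota andbT => kk.
  by apply/zfree_Pwr/zfreeD; [apply/zfree_pv/rg; lia|apply: zfree1].
apply: zfreeV; rewrite big_seq_cond; apply: zfree_prod => k; rewrite mem_index_iota andbT => kk.
by apply/zfree_Pwr/zfree_pv/rg; lia.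
Qed.

Lemma zfree_eres be i r : (0 < i)%N -> (i < be)%N -> in_range a i be r ->
  zfree (eres a (pv R rr ss) i be r).
Proof.
move=> i0 ibe rg; apply: zfreeM.
  apply/zfreeN/zfreeM.
    by apply/zfree_Pw/zfreeD; [apply/zfree_pv/rg; lia|apply/zfreeN/zfree1].
  rewrite big_seq_cond; apply: zfree_prod => k; rewrite mem_index_iota andbT => kk.
  by apply/zfree_Pwr/zfreeD; [apply/zfree_pv/rg; lia|apply/zfreeN/zfree1].
apply: zfreeV; rewrite big_seq_cond; apply: zfree_prod => k; rewrite mem_index_iota andbT => kk.
by apply/zfree_Pwr/zfree_pv/rg; lia.
Qed.

End ZFree.

(** * The entries of T_D(z) *)

Section Assembly.
Variables (R : realType) (rr ss : nat).
Local Notation n := (nn rr ss).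
Local Notation a := (aa rr ss).
Local Notation tuples := {ffun 'I_n -> 'I_n}.
Local Notation Fld := (Fld R rr ss).
Local Notation Ex := (Ex rr ss).
Local Notation Elt := (Elt R rr ss).
Local Notation p := (pv R rr ss).
Local Notation z := (zv R rr ss).

(** Pairing with an arbitrary function of the exponent. Indicators give the coefficients, and a
    general [G] lets a product be expanded one factor at a time. *)
Definition eltSum (u : Elt) (G : Ex -> Fld) : Fld := \sum_(x <- u) x.1 * G x.2.

Lemma eltCoefE u m : eltCoef u m = eltSum u (fun m' => (m' == m)%:R).
Proof.
rewrite /eltCoef big_mkcond; apply: eq_bigr => x _.
by case: eqP => _; rewrite ?mulr1 ?mulr0.
Qed.

Lemma eltSum_flatten (I : Type) (s : seq I) (F : I -> Elt) G :
  eltSum (flatten [seq F i | i <- s]) G = \sum_(i <- s) eltSum (F i) G.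
Proof. by rewrite /eltSum big_flatten big_map. Qed.

Lemma eltSum_mul u v G :
  eltSum (eltMul u v) G = eltSum u (fun m => \sum_(y <- v) shiftF m y.1 * G (m + y.2)).
Proof.
rewrite /eltSum /eltMul big_allpairs_dep /=; apply: eq_bigr => x _.
rewrite mulr_sumr; apply: eq_bigr => y _; rewrite mulrA; congr (_ * G _).
Qed.

Lemma ex0E : ex0 rr ss = 0.
Proof. by apply/ffunP => j; rewrite !ffunE. Qed.

(** The empty selection, which indexes the single term of a diagonal entry of f or e. *)
Definition tuple0 : tuples := [ffun k => insubd k 0%N].

Lemma valid_refl i (rho : tuples) : valid i i rho = (rho == tuple0).
Proof.
apply/forallP/eqP => [V|-> k]; last first.
  have -> : (i <= k < i)%N = false by lia.
  by rewrite ffunE val_insubd (leq_ltn_trans (leq0n k)).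
apply/ffunP => k; apply: val_inj; rewrite ffunE val_insubd (leq_ltn_trans (leq0n k)) //.
have := V k; have -> : (i <= k < i)%N = false by lia.
by move/eqP.
Qed.

Lemma sumq_refl i rho : sumq i i rho = 0 :> Ex.
Proof. by apply/ffunP => t; rewrite !ffunE big_geq. Qed.

Lemma ffun_oppE (m : Ex) : [ffun t => - m t] = - m.
Proof. by apply/ffunP => j; rewrite !ffunE. Qed.

Lemma big_fD (H : Fld -> Ex -> Fld) al i : (i <= al)%N ->
  \sum_(x <- fD R rr ss al i) H x.1 x.2 =
  \sum_(rho | valid i al rho) H (fval a p al i (rsel rho) z) (- sumq i al rho).
Proof.
move=> ial; rewrite /fD /fval; case: eqVneq => [->|ne].
  rewrite big_seq1 /= (eq_bigl _ _ (valid_refl al)) big_pred1_eq ltnn sumq_refl oppr0 ex0E //.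
have lt : (i < al)%N by lia.
rewrite lt big_map big_enum /=; apply: eq_bigr => rho _.
by rewrite ffun_oppE /fCoef /fres invfM mulrA mulrAC.
Qed.

Lemma big_eD (H : Fld -> Ex -> Fld) i be : (i <= be)%N ->
  \sum_(x <- eD R rr ss i be) H x.1 x.2 =
  \sum_(rho | valid i be rho) H (eval a p i be (rsel rho) z) (sumq i be rho).
Proof.
move=> ibe; rewrite /eD /eval; case: eqVneq => [->|ne].
  rewrite big_seq1 /= (eq_bigl _ _ (valid_refl be)) big_pred1_eq ltnn sumq_refl ex0E //.
have lt : (i < be)%N by lia.
rewrite lt big_map big_enum /=; apply: eq_bigr => rho _.
by rewrite /eCoef /eres invfM mulrA mulrAC.
Qed.

Lemma eltSum_fD al i G : (i <= al)%N ->
  eltSum (fD R rr ss al i) G =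
  \sum_(rho | valid i al rho) fval a p al i (rsel rho) z * G (- sumq i al rho).
Proof. exact: (big_fD (fun c m => c * G m)). Qed.

Lemma sumqE i al (rho : tuples) k t : (al <= n)%N -> valid i al rho ->
  (0 < t <= a k)%N ->
  sumq i al rho (pidx rr ss k t) = ((i <= k < al)%N && (t == rsel rho k))%:R :> int.
Proof.
move=> aln V ta; have Rg := valid_in_range aln V.
rewrite ffunE (eq_big_nat _ _ (F2 := fun k' => if k' == k then (t == rsel rho k)%:R else 0 : int)).
  rewrite -big_mkcond /=; case: (boolP (i <= k < al)%N) => kk /=.
    by rewrite big_nat1_eq kk.
  by rewrite big_nat1_eq (negPf kk).
move=> k' kk; rewrite ffunE pidx_eq ?Rg // eq_sym; case: eqP => [->|] //=.
by case: eqP.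
Qed.

(** [shiftF m] subtracts [m], so the negative exponents of f add 1 to the selected p's. *)
Lemma shiftF_sumq i al (rho : tuples) k t : (al <= n)%N -> valid i al rho ->
  (0 < t <= a k)%N ->
  shiftF (- sumq i al rho) (p k t) = shifted p i al (rsel rho) k t.
Proof.
move=> aln V ta; rewrite shiftF_pv ?pidx_neq_z // ffunE sumqE // rmorphN opprK /shifted.
by case: (_ && _).
Qed.

(** Coefficient of one term of f g e after the exponential of f has been moved to the right past g
    and e. *)
Definition TD_term al be i (rho rho' : tuples) : Fld :=
  fval a p al i (rsel rho) z *
  (Pw a (shifted p i al (rsel rho)) i z / Pw a (shifted p i al (rsel rho)) i.-1 (z - 1))
  * eval a (shifted p i al (rsel rho)) i be (rsel rho') z.

Lemma eltSum_TD al be G : (al <= n)%N -> (be <= n)%N ->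
  eltSum (TD R rr ss al be) G = \sum_(1 <= i < (minn al be).+1)
    \sum_(rho | valid i al rho) \sum_(rho' | valid i be rho')
      TD_term al be i rho rho' * G (- sumq i al rho + sumq i be rho').
Proof.
move=> aln ben; rewrite eltSum_flatten /index_iota subn1 [LHS]big_seq [RHS]big_seq.
apply: eq_bigr => i; rewrite mem_iota => im; rewrite !eltSum_mul.
have [ial ibe] : (i <= al)%N /\ (i <= be)%N by lia.
rewrite eltSum_fD //; apply: eq_bigr => rho V.
rewrite big_seq1 /= ex0E addr0.
rewrite (big_eD (fun c m => shiftF (- sumq i al rho) c * G (- sumq i al rho + m))) // !mulr_sumr; apply: eq_bigr => rho' V'.
rewrite /TD_term -[RHS]mulrA -[RHS]mulrA; congr (_ * _).
have sp k t := @shiftF_sumq i al rho k t aln V.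
have -> : shiftF (- sumq i al rho) (eval a p i be (rsel rho') z) =
    eval a (shifted p i al (rsel rho)) i be (rsel rho') z.
  by apply: (eval_morph sp) (shiftF_zv _ _); apply: valid_in_range V'.
congr (_ * _); rewrite fmorph_div.
by rewrite (Pw_morph sp) (Pw_morph sp) rmorphB rmorph1 /= shiftF_zv.
Qed.

Lemma sumq_set_entry i j (rho : tuples) t : (i < j)%N -> (j <= n)%N -> (0 < t <= a i)%N ->
  sumq i j (set_entry rho i t) = qexp rr ss i t + sumq i.+1 j rho :> Ex.
Proof.
move=> ij jn ta; apply/ffunP => u; rewrite ffunE [RHS]ffunE big_ltn //.
have [_ iN tn] := a_range ta; rewrite rsel_set_entry //; congr (_ + _).
rewrite ffunE; apply: eq_big_nat => k kk; rewrite rsel_set_entry_neq //; lia.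
Qed.

(** The contributions -q_{i,t} and q_{i,t} cancel; this is the weight condition of the
    telescoping. *)
Lemma exponent_step al be (G : Ex -> Fld) i t (rho rho' : tuples) :
  (al <= n)%N -> (be <= n)%N -> (i < al)%N -> (i < be)%N -> (0 < t <= a i)%N ->
  G (- sumq i al (set_entry rho i t) + sumq i be (set_entry rho' i t)) =
  G (- sumq i.+1 al rho + sumq i.+1 be rho').
Proof.
move=> aln ben ial ibe ta; rewrite !sumq_set_entry //; congr G.
by rewrite opprD addrACA addNr add0r.
Qed.

Lemma exponent_telescope al be (h : Fld -> Fld) (G : Ex -> Fld) : (al <= n)%N -> (be <= n)%N ->
  \sum_(1 <= i < (minn al be).+1) \sum_(rho : tuples | valid i al rho)
    \sum_(rho' : tuples | valid i be rho')
      G (- sumq i al rho + sumq i be rho') *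
      sum_poles a p al be i (rsel rho) (rsel rho') h = 0.
Proof.
move=> aln ben.
apply: (@sum_poles_telescope _ _ _ _ (@pv_gen R rr ss) _ _ h
  (fun i rho rho' => G (- sumq i al rho + sumq i be rho')) aln ben).
by move=> i t rho rho'; apply: exponent_step.
Qed.

Lemma z_notin_poles al be i (rho rho' : tuples) : (al <= n)%N -> (be <= n)%N ->
  valid i al rho -> valid i be rho' ->
  z \notin poles a p al be i (rsel rho) (rsel rho').
Proof.
move=> aln ben V V'.
have nl : z \notin lower_poles a p i.
  apply/mapP => -[s]; rewrite mem_index_iota => si E.
  have /negP[] := @zv_gen R rr ss i.-1 s 1 si.
  by rewrite E addrAC subrr add0r.
rewrite /poles; case: ltnP => // ibe; rewrite inE negb_or nl andbT.
have ri' : (0 < rsel rho' i <= a i)%N by apply: (valid_in_range ben V'); rewrite leqnn.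
rewrite /upper_pole /shifted; case: (_ && (_ == _)) => /=.
  by rewrite -subr_eq0 opprD addrA subr_eq0; exact: (zv_gen R 1 ri').
by rewrite addr0 -subr_eq0; exact: (zv_gen R 0 ri').
Qed.

(** Telescoping with h(x) = 1/(z - x) removes all polar parts, leaving the constants. *)
Lemma eltSum_TD_leading al be G : (al <= n)%N -> (be <= n)%N ->
  (forall i r r', (0 < i <= minn al be)%N -> in_range a i al r ->
     (size (numer a p al be i r r') <= (a i.-1 + (i < be)).+1)%N) ->
  eltSum (TD R rr ss al be) G = \sum_(1 <= i < (minn al be).+1)
    \sum_(rho : tuples | valid i al rho) \sum_(rho' : tuples | valid i be rho')
      (numer a p al be i (rsel rho) (rsel rho'))`_(a i.-1 + (i < be))
        * G (- sumq i al rho + sumq i be rho').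
Proof.
move=> aln ben sz; rewrite eltSum_TD //.
rewrite -[RHS]addr0 -[X in _ = _ + X](exponent_telescope (fun x => (z - x)^-1) G aln ben).
rewrite -big_split; apply: eq_big_nat => i im /=.
rewrite -big_split; apply: eq_bigr => rho V /=.
rewrite -big_split; apply: eq_bigr => rho' V' /=.
have Rg := valid_in_range aln V; have Rg' := valid_in_range ben V'.
rewrite /TD_term (term_partial_fractions (@pv_gen R rr ss) _ _ Rg Rg') ?z_notin_poles //; try lia.
- by rewrite mulrDl [G _ * _]mulrC.
- move=> ial; rewrite subr_eq0; apply: (zv_gen R 1); apply: Rg; lia.
- by apply: sz => //; lia.
Qed.

Lemma residues_sum al be G : (al <= n)%N -> (be <= n)%N ->
  (forall i r r', (0 < i <= minn al be)%N -> in_range a i al r ->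
     (size (numer a p al be i r r') <= a i.-1 + (i < be))%N) ->
  \sum_(1 <= i < (minn al be).+1)
    \sum_(rho : tuples | valid i al rho) \sum_(rho' : tuples | valid i be rho')
      (numer a p al be i (rsel rho) (rsel rho'))`_(a i.-1 + (i < be)).-1
        * G (- sumq i al rho + sumq i be rho') = 0.
Proof.
move=> aln ben sz.
rewrite -[RHS](exponent_telescope (fun=> 1) G aln ben).
apply: eq_big_nat => i im; apply: eq_bigr => rho V; apply: eq_bigr => rho' V'.
have Rg := valid_in_range aln V; have Rg' := valid_in_range ben V'.
rewrite (numer_residues (@pv_gen R rr ss) _ Rg') ?(mulrC (G _)) //; first lia.
by apply: sz => //; lia.
Qed.

(** * Degree counts for the blocks, and the product of K and Kbar *)

Lemma size_numer al be i r r' : (i <= al)%N -> in_range a i al r ->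
  (size (numer a p al be i r r') <= (a i).+1 - (i < al))%N.
Proof.
move=> ial Rg; have sf : (size (fpoly a p al i r) <= (a i).+1 - (i < al))%N.
  by apply: size_fpoly => // lt; apply: Rg; rewrite leqnn.
rewrite /numer; case: ifP => // _.
exact: leq_trans (size_scale_leq _ _) sf.
Qed.

Lemma lead_numer al be i r r' : (i <= al)%N -> in_range a i al r ->
  (numer a p al be i r r')`_(a i - (i < al)) =
  (if (i < al)%N then fres a p al i r else 1) *
  (if (i < be)%N then eres a (shifted p i al r) i be r' else 1).
Proof.
move=> ial Rg; have lf : (fpoly a p al i r)`_(a i - (i < al)) =
    if (i < al)%N then fres a p al i r else 1.
  by apply: lead_fpoly => // lt; apply: Rg; rewrite leqnn.
rewrite /numer; case: (ltnP i be) => _; last by rewrite mulr1.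
by rewrite coefZ lf mulrC.
Qed.

Lemma eltSum_K al be G : (0 < be <= rr)%N -> (rr + ss < al <= n)%N ->
  eltSum (TD R rr ss al be) G =
  \sum_(rho : tuples | valid be al rho) fres a p al be (rsel rho) * G (- sumq be al rho).
Proof.
move=> beP alP; have aln : (al <= n)%N by lia.
have ben : (be <= n)%N by rewrite /nn; lia.
have aE i : (i <= rr)%N -> a i = i by rewrite /aa => ->.
have mE : minn al be = be by lia.
rewrite eltSum_TD_leading //; last first.
  move=> i r r' im Rg; apply: leq_trans (size_numer _ _ _ Rg) _; first lia.
  by rewrite !aE; lia.
rewrite mE big_nat_recr /=; last lia.
(* For i < be the degree is at most i-1 while there are i poles, so the constant is 0. At i = be
   both numbers are be-1 and the leading coefficient remains. *)
rewrite big_nat_cond big1 ?add0r; last first.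
  move=> i /andP[im _]; apply: big1 => rho V; apply: big1 => rho' V'.
  rewrite nth_default ?mul0r //.
  apply: leq_trans (size_numer _ _ _ (valid_in_range aln V)) _; first lia.
  by rewrite !aE; lia.
apply: eq_bigr => rho V.
rewrite (eq_bigl _ _ (valid_refl be)) big_pred1_eq sumq_refl addr0; congr (_ * _).
have := lead_numer be (rsel tuple0) _ (valid_in_range aln V).
rewrite ltnn; have -> : (be < al)%N by lia.
rewrite mulr1 => <-; last lia.
by congr (_`_ _); rewrite !aE; lia.
Qed.

Lemma eltSum_Kbar al be G : (0 < al <= rr)%N -> (rr + ss < be <= n)%N ->
  eltSum (TD R rr ss al be) G =
  \sum_(rho : tuples | valid al be rho) eres a p al be (rsel rho) * G (sumq al be rho).
Proof.
move=> alP beP; have ben : (be <= n)%N by lia.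
have aln : (al <= n)%N by rewrite /nn; lia.
have aE i : (i <= rr)%N -> a i = i by rewrite /aa => ->.
have mE : minn al be = al by lia.
rewrite eltSum_TD_leading //; last first.
  move=> i r r' im Rg; apply: leq_trans (size_numer _ _ _ Rg) _; first lia.
  by rewrite !aE; lia.
rewrite mE big_nat_recr /=; last lia.
rewrite big_nat_cond big1 ?add0r; last first.
  move=> i /andP[im _]; apply: big1 => rho V; apply: big1 => rho' V'.
  rewrite nth_default ?mul0r //.
  apply: leq_trans (size_numer _ _ _ (valid_in_range aln V)) _; first lia.
  by rewrite !aE; lia.
rewrite (eq_bigl _ _ (valid_refl al)) big_pred1_eq sumq_refl oppr0.
apply: eq_bigr => rho V; rewrite add0r; congr (_ * _).
have V0 : valid al al tuple0 by rewrite valid_refl.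
have := lead_numer be (rsel rho) (leqnn al) (valid_in_range aln V0).
rewrite ltnn; have lt : (al < be)%N by lia.
rewrite lt mul1r => E; transitivity (eres a (shifted p al al (rsel tuple0)) al be (rsel rho)).
  by rewrite -E; congr (_`_ _); rewrite !aE; lia.
(* The diagonal entry of f carries no exponential, so the shift is trivial. *)
apply: eres_eq => // k t _; rewrite /shifted.
by rewrite ltnNge andbN addr0.
Qed.

(** Telescoping with h = 1: each residue sum is the coefficient of the numerator in degree one less
    than the number of poles. The summands with i <= r give the left side, the others the right
    side. *)
Lemma corner_block_residues al be G : (rr + ss < al <= n)%N -> (rr + ss < be <= n)%N ->
  \sum_(1 <= i < rr.+1)
    \sum_(rho : tuples | valid i al rho) \sum_(rho' : tuples | valid i be rho')
      fres a p al i (rsel rho) *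
      eres a (shifted p i al (rsel rho)) i be (rsel rho') *
      G (- sumq i al rho + sumq i be rho')
  = if al == be then - G 0 else 0.
Proof.
move=> alP beP; have aln : (al <= n)%N by lia.
have ben : (be <= n)%N by lia.
have aE1 i : (i <= rr)%N -> a i = i by rewrite /aa => ->.
have aE2 i : (rr <= i <= rr + ss)%N -> a i = rr.
  by rewrite /aa => h; have [h1|h1] := leqP i rr; [lia|have [|] := leqP i (rr + ss); lia].
have aE3 i : (rr + ss <= i)%N -> a i = (n - i)%N.
  rewrite /aa /nn => h; have [h1|h1] := leqP i rr; first lia.
  by have [|] := leqP i (rr + ss); lia.
have az i : (0 < i <= minn al be)%N -> [\/ (i <= rr)%N /\ a i = i /\ a i.-1 = i.-1,
    (rr < i <= rr + ss)%N /\ a i = rr /\ a i.-1 = rr |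
    (rr + ss < i)%N /\ a i = (n - i)%N /\ a i.-1 = (n - i).+1].
  move=> im; have [h1|h1] := leqP i rr; first by apply: Or31; rewrite !aE1 //; lia.
  have [h2|h2] := leqP i (rr + ss); first by apply: Or32; rewrite !aE2 //; lia.
  by apply: Or33; rewrite !aE3 //; lia.
have sz i r r' : (0 < i <= minn al be)%N -> in_range a i al r ->
    (size (numer a p al be i r r') <= a i.-1 + (i < be))%N.
  move=> im Rg; apply: leq_trans (size_numer _ _ _ Rg) _; first lia.
  by case: (az _ im) => -[h [-> ->]]; lia.
have := residues_sum G aln ben sz; rewrite (@big_cat_nat _ _ _ rr.+1) //=; last by lia.
set S1 := (X in X + _ = 0 -> _); set S2 := (X in _ + X = 0 -> _) => E.
(* For i <= r there are i poles and the degree is at most i-1, so the coefficient is the product of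
   [fres] and the shifted [eres]. *)
transitivity S1.
  apply: eq_big_nat => i im; apply: eq_bigr => rho V; apply: eq_bigr => rho' V'.
  congr (_ * _); have := lead_numer be (rsel rho') _ (valid_in_range aln V).
  have -> : (i < al)%N by lia. have -> : (i < be)%N by lia.
  move=> <-; last lia.
  by congr (_`_ _); rewrite !aE1; lia.
move/eqP: E; rewrite addr_eq0 => /eqP ->; suff -> : S2 = if al == be then G 0 else 0.
  by case: eqP; rewrite ?oppr0.
have mm : (rr < minn al be)%N by lia.
(* For r < i < min(al, be) the degree is at least two below the number of poles, so nothing is
   contributed. The same holds at i = min(al, be) if al and be differ. *)
rewrite /S2 big_nat_recr //= big_nat_cond big1 ?add0r; last first.
  move=> i /andP[im _]; apply: big1 => rho V; apply: big1 => rho' V'.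
  rewrite nth_default ?mul0r //.
  apply: leq_trans (size_numer _ _ _ (valid_in_range aln V)) _; first lia.
  by case: (az i _) => [|[h [-> ->]]|[h [-> ->]]|[h [-> ->]]]; lia.
case: eqVneq => [eab|ne]; last first.
  apply: big1 => rho V; apply: big1 => rho' V'.
  rewrite nth_default ?mul0r //.
  apply: leq_trans (size_numer _ _ _ (valid_in_range aln V)) _; first lia.
  by case: (az (minn al be) _) => [|[h [-> ->]]|[h [-> ->]]|[h [-> ->]]]; lia.
(* At i = al = be the numerator is monic of degree n - al and there are n - al + 1 poles, so the
   coefficient is 1. *)
subst be; rewrite minnn (eq_bigl _ _ (valid_refl al)) big_pred1_eq (eq_bigl _ _ (valid_refl al)) big_pred1_eq.
rewrite sumq_refl oppr0 addr0 -[RHS]mul1r; congr (_ * _).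
have V0 : valid al al tuple0 by rewrite valid_refl.
have := lead_numer al (rsel tuple0) (leqnn al) (valid_in_range aln V0).
rewrite ltnn mul1r => <-; congr (_`_ _).
by case: (az al _) => [|[h [-> ->]]|[h [-> ->]]|[h [-> ->]]]; lia.
Qed.

Lemma zfree_natb (b : bool) : zfree (b%:R : Fld).
Proof. by case: b; [apply: zfree1 | apply: zfree0]. Qed.

Lemma zfree_K b c m : (0 < b <= rr)%N -> (0 < c <= rr)%N -> zfree (eltCoef (Kblk R rr ss b c) m).
Proof.
move=> hb hc; have aln : (rr + ss + b <= n)%N by rewrite /nn; lia.
rewrite eltCoefE eltSum_K //; last by rewrite aln; lia.
apply: zfree_sum => rho V; apply: zfreeM (zfree_natb _).
by apply: zfree_fres (valid_in_range aln V); lia.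
Qed.

Lemma zfree_Kbar b c m : (0 < b <= rr)%N -> (0 < c <= rr)%N -> zfree (eltCoef (Kbar R rr ss b c) m).
Proof.
move=> hb hc; have aln : (rr + ss + c <= n)%N by rewrite /nn; lia.
rewrite eltCoefE eltSum_Kbar //; last by rewrite aln; lia.
apply: zfree_sum => rho V; apply: zfreeM (zfree_natb _).
by apply: zfree_eres (valid_in_range aln V); lia.
Qed.

Lemma shiftF_eltSum m v m0 :
  \sum_(y <- v) shiftF m y.1 * (m + y.2 == m0)%:R =
  shiftF m (eltSum v (fun m' => (m + m' == m0)%:R)).
Proof. by rewrite rmorph_sum; apply: eq_bigr => y _; rewrite rmorphM rmorph_nat. Qed.

Lemma K_Kbar b c : (0 < b <= rr)%N -> (0 < c <= rr)%N ->
  eltEq (KKbar R rr ss b c) (eltC (if b == c then -1 else 0)).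
Proof.
move=> hb hc m0; have aln : (rr + ss + b <= n)%N by rewrite /nn; lia.
have ben : (rr + ss + c <= n)%N by rewrite /nn; lia.
rewrite !eltCoefE eltSum_flatten [RHS]big_seq1 /= ex0E.
transitivity (if (rr + ss + b == rr + ss + c)%N then - (0 == m0)%:R else 0 : Fld); last first.
  by rewrite eqn_add2l; case: eqP => _; rewrite ?mulN1r ?mul0r.
rewrite -(corner_block_residues (fun m => (m == m0)%:R)) ?aln ?ben ?andbT; try lia.
(* The summand i of the residue identity is the term of the matrix product with intermediate index
   i. *)
rewrite /index_iota subn1; apply: eq_big_seq => i; rewrite mem_iota => im.
rewrite eltSum_mul eltSum_K; [|lia|by rewrite aln; lia].
apply: eq_bigr => rho V; rewrite shiftF_eltSum eltSum_Kbar; [|lia|by rewrite ben; lia].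
rewrite rmorph_sum mulr_sumr; apply: eq_bigr => rho' V'.
rewrite rmorphM rmorph_nat mulrA; congr (_ * _ * _).
(* Moving the exponential of K past the coefficient of Kbar turns [eres] at p into [eres] at the
   shifted p. *)
have sp k t := @shiftF_sumq i (rr + ss + b) rho k t aln V.
by apply: (eres_morph sp) (valid_in_range ben V'); lia.
Qed.

End Assembly.

Theorem theorem2p44 (R : realType) (r s : nat) :
  (0 < r)%N -> (0 < s)%N ->
  (forall a b : nat, (1 <= a <= r)%N -> (1 <= b <= r)%N ->
     (forall m, zfree (eltCoef (Kblk R r s a b) m)) /\
     (forall m, zfree (eltCoef (Kbar R r s a b) m))) /\
  (forall a b : nat, (1 <= a <= r)%N -> (1 <= b <= r)%N ->
     eltEq (KKbar R r s a b) (eltC (if a == b then -1 else 0))).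
Proof.
move=> _ _; split=> a b ha hb; last exact: K_Kbar.
by split=> m; [apply: zfree_K | apply: zfree_Kbar].
Qed.
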